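(* Let $W$ be a group with a finite generating set $S=\{s_1,\dots,s_k\}$, and let $(V_1,\rho_1)$, $(V_2,\rho_2)$ be irreducible reflection representations of $(W,S)$ over a field $\mathbb{F}$ of characteristic $0$, of dimensions $n_1$ and $n_2$. Suppose $\bigwedge^{d_1}V_1\simeq\bigwedge^{d_2}V_2$ as $W$-modules for some integers $d_1,d_2$ with $1\le d_\iota\le n_\iota-1$ for $\iota=1,2$. Then $d_1=d_2$, $n_1=n_2$, and $V_1\simeq V_2$ as $W$-modules.
   Context: A linear map $s:V\to V$ on a finite-dimensional $\mathbb{F}$-vector space is called a (generalized) reflection if $s$ is diagonalizable and $\operatorname{rank}(s-\operatorname{Id}_V)=1$. A representation $(V,\rho)$ of $W$ on a finite-dimensional $\mathbb{F}$-vector space is a reflection representation of $(W,S)$ if $\rho(s_i)$ is a reflection on $V$ for every $i\in\{1,\dots,k\}$. The group $W$ acts on $\bigwedge^d V$ by $w\cdot(v_1\wedge\cdots\wedge v_d)=(w v_1)\wedge\cdots\wedge(w v_d)$. *)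

(* Defs.v *)
From HB Require Import structures.
From mathcomp Require Import all_boot all_order all_algebra.
From mathcomp Require Import monoid.
Set Implicit Arguments.
Unset Strict Implicit.
Unset Printing Implicit Defensive.
Import GRing.Theory.
Local Open Scope ring_scope.

(* Convention: a representation of degree n of a group W over F is a map
   rho : W -> 'M[F]_n which is a group homomorphism into GL_n(F); the matrices
   act on COLUMN vectors of F^n (v |-> rho w *m v). *)

Inductive in_gen_subgroup (W : groupType) (k : nat) (S : 'I_k -> W) : W -> Prop :=
  | gen_one : in_gen_subgroup S 1%g
  | gen_mulS : forall w i, in_gen_subgroup S w -> in_gen_subgroup S (w * S i)%g
  | gen_mulSV : forall w i, in_gen_subgroup S w -> in_gen_subgroup S (w * (S i)^-1)%g.

Definition generates (W : groupType) (k : nat) (S : 'I_k -> W) : Prop :=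
  forall w : W, in_gen_subgroup S w.

Definition is_rep (W : groupType) (F : fieldType) (n : nat) (rho : W -> 'M[F]_n) :=
  rho 1%g = 1%:M /\ forall x y : W, rho (x * y)%g = rho x *m rho y.

(* U (via its row space, i.e. the column space of U^T) is a W-stable subspace
   of the column space F^n. *)
Definition rep_stable (W : groupType) (F : fieldType) (n : nat)
    (rho : W -> 'M[F]_n) (U : 'M[F]_n) :=
  forall w : W, (U *m (rho w)^T <= U)%MS.

Definition rep_irreducible (W : groupType) (F : fieldType) (n : nat)
    (rho : W -> 'M[F]_n) :=
  (0 < n)%N /\
  forall U : 'M[F]_n, rep_stable rho U -> U = 0 \/ row_full U.

Definition is_reflection (F : fieldType) (n : nat) (s : 'M[F]_n) :=
  diagonalizable s /\ \rank (s - 1%:M) = 1%N.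

Definition reflection_rep (W : groupType) (F : fieldType) (n k : nat)
    (S : 'I_k -> W) (rho : W -> 'M[F]_n) :=
  is_rep rho /\ forall i : 'I_k, is_reflection (rho (S i)).

(* Basis of the exterior power /\^d F^n : e_{f 0} /\ ... /\ e_{f (d-1)} for
   strictly increasing f : 'I_d -> 'I_n. *)
Definition incr_seq (d n : nat) :=
  {f : {ffun 'I_d -> 'I_n} | [forall i : 'I_d, forall j : 'I_d,
                               (i < j)%N ==> (f i < f j)%N]}.

Definition wedge_dim (d n : nat) := #|{: incr_seq d n}|.

(* Matrix of /\^d A in the basis above (entries are d x d minors of A). *)
Definition wedge_mx (F : fieldType) (d n : nat) (A : 'M[F]_n) :
    'M[F]_(wedge_dim d n) :=
  \matrix_(i, j) \det (\matrix_(a < d, b < d)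
        A (val (@enum_val _ {: incr_seq d n} i) a)
          (val (@enum_val _ {: incr_seq d n} j) b)).

Definition wedge_rep (W : groupType) (F : fieldType) (d n : nat)
    (rho : W -> 'M[F]_n) : W -> 'M[F]_(wedge_dim d n) :=
  fun w => wedge_mx d (rho w).

Definition rep_iso (W : groupType) (F : fieldType) (m1 m2 : nat)
    (rho1 : W -> 'M[F]_m1) (rho2 : W -> 'M[F]_m2) :=
  exists P : 'M[F]_(m2, m1),
    [/\ row_free P, row_full P & forall w : W, P *m rho1 w = rho2 w *m P].

(* Main.v *)
Require Import Defs.
From HB Require Import structures.
From mathcomp Require Import all_boot all_order all_algebra.
From mathcomp Require Import monoid.
From mathcomp Require Import perm ring zify.
Set Implicit Arguments.
Unset Strict Implicit.
Unset Printing Implicit Defensive.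
Import GRing.Theory.
Local Open Scope ring_scope.

(* A reflection is s = 1 + N with N = u v of rank one and tr N <> 0, and
   /\^d s = 1 + D N, where D : gl(V) -> gl(/\^d V) is the derivation extending
   X to the exterior power.  D is a Lie morphism with
     tr (D X) = C(n-1,d-1) tr X,
     tr (D X D Y) = C(n-2,d-1) tr (X Y) + C(n-2,d-2) tr X tr Y,
   hence is injective for 0 < d < n in characteristic 0.

   Comparing tr (D N) and tr (D N)^2 on both sides of the isomorphism
   P : /\^d1 V1 -> /\^d2 V2 gives C(n1-1,d1-1) = C(n2-1,d2-1); together with
   C(n1,d1) = C(n2,d2) this forces d1/n1 = d2/n2 and then d1 = d2, n1 = n2.

   Say (X1, X2) is intertwined if P (D X1) = (D X2) P.  Intertwined pairs form a
   Lie algebra on which the trace forms agree, and for N of rank one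
     2 (tr N) N X = [N,[N,X]] + 2 tr (N X) N + (tr N) [N,X],
   so they are stable under left multiplication by the pairs (N1, N2) coming
   from a generator.  Fixing one such pair (u1 v1, u2 v2), the pairs (x1, x2)
   with (x1 v1, x2 v2) intertwined form a W-stable subspace of V1 x V2 which is
   the graph of an isomorphism V1 -> V2. *)

(** * Matrices indexed by finite types *)

Section FinMatrix.

Definition fmx (R : Type) (I J : finType) (phi : I -> J -> R) : 'M[R]_(#|{: I}|, #|{: J}|) :=
  \matrix_(i, j) phi (enum_val i) (enum_val j).

Lemma fmxE (R : Type) (I J : finType) (phi : I -> J -> R) i j :
  fmx phi (enum_rank i) (enum_rank j) = phi i j.
Proof. by rewrite mxE !enum_rankK. Qed.

Lemma eq_fmx (R : Type) (I J : finType) (A B : 'M[R]_(#|{: I}|, #|{: J}|)) :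
  (forall i j, A (enum_rank i) (enum_rank j) = B (enum_rank i) (enum_rank j)) ->
  A = B.
Proof. by move=> AB; apply/matrixP=> i j; rewrite -(enum_valK i) -(enum_valK j). Qed.

Lemma sum_enum_rank (V : nmodType) (I : finType) (phi : 'I_#|{: I}| -> V) :
  \sum_i phi i = \sum_(i : I) phi (enum_rank i).
Proof.
rewrite (reindex (@enum_rank I)) //=.
by exists enum_val => i _; rewrite (enum_rankK, enum_valK).
Qed.

Lemma mulmx_enumE (R : pzSemiRingType) (I J K : finType) (A : 'M[R]_(#|{: I}|, #|{: J}|))
    (B : 'M_(_, #|{: K}|)) i k :
  (A *m B) (enum_rank i) (enum_rank k) =
  \sum_(j : J) A (enum_rank i) (enum_rank j) * B (enum_rank j) (enum_rank k).
Proof. by rewrite mxE sum_enum_rank. Qed.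

End FinMatrix.

(** * Increasing maps, the index set of the exterior basis *)

Section Incr.
Variables (d n : nat).

Definition incr (f : {ffun 'I_d -> 'I_n}) :=
  [forall i : 'I_d, forall j : 'I_d, (i < j)%N ==> (f i < f j)%N].

Lemma incrP (f : {ffun 'I_d -> 'I_n}) :
  reflect (forall i j : 'I_d, (i < j)%N -> (f i < f j)%N) (incr f).
Proof.
apply: (iffP forallP) => [h i j | h i].
  by move/forallP/(_ j)/implyP: (h i).
by apply/forallP=> j; apply/implyP/h.
Qed.

Lemma incr_inj (f : {ffun 'I_d -> 'I_n}) : incr f -> injective f.
Proof.
move/incrP=> fi i j fij; have [ij|ji|/val_inj//] := ltngtP i j.
  by have := fi _ _ ij; rewrite fij ltnn.
by have := fi _ _ ji; rewrite fij ltnn.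
Qed.

Lemma incr_sorted (f : {ffun 'I_d -> 'I_n}) :
  incr f -> sorted ltn [seq val (f i) | i <- enum 'I_d].
Proof.
move=> /incrP fi.
have : sorted (relpre val ltn) (enum 'I_d).
  by rewrite -sorted_map val_enum_ord iota_ltn_sorted.
rewrite sorted_map; apply: sub_sorted => i j; exact: fi.
Qed.

(** Both lists of values are strictly sorted with the same members, hence equal. *)
Lemma incr_eq_codom (f g : {ffun 'I_d -> 'I_n}) :
  incr f -> incr g -> codom f =i codom g -> f = g.
Proof.
move=> fi gi fg.
have E : [seq val (f i) | i <- enum 'I_d] = [seq val (g i) | i <- enum 'I_d].
  apply: irr_sorted_eq (incr_sorted fi) (incr_sorted gi) _.
  - exact: ltn_trans.
  - exact: ltnn.
  have Ec (h : {ffun 'I_d -> 'I_n}) : [seq val (h i) | i <- enum 'I_d] = map val (codom h).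
    by rewrite codomE -[RHS]map_comp.
  by rewrite !Ec; apply: eq_mem_map.
by apply/ffunP=> i; apply: val_inj; move/eq_in_map: E => /(_ i); apply; rewrite mem_enum.
Qed.

(** Sorting the values of [g] gives a weakly increasing list, and injectivity makes it strict. *)
Lemma incr_sort (g : {ffun 'I_d -> 'I_n}) : injective g ->
  exists (f : {ffun 'I_d -> 'I_n}) (s : {perm 'I_d}),
    incr f /\ g = [ffun a => f (s a)].
Proof.
move=> gI.
pose t := [tuple g i | i < d]; pose le := relpre (val : 'I_n -> nat) leq.
have leT : transitive le by move=> x y z; apply: leq_trans.
have Ut : uniq (sort le t) by rewrite sort_uniq map_inj_uniq ?enum_uniq.
have [s gs] : exists s : {perm 'I_d},
    val t = [tuple tnth (sort_tuple le t) (s i) | i < d].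
  by apply/tuple_permP; rewrite perm_sym /= perm_sort.
exists [ffun a => tnth (sort_tuple le t) a], s; split.
  apply/incrP=> i j ij; rewrite !ffunE.
  have x0 : 'I_n := g i.
  have lij : le (tnth (sort_tuple le t) i) (tnth (sort_tuple le t) j).
    have leS : sorted le (sort le t) by apply: sort_sorted => x y; apply: leq_total.
    rewrite !(tnth_nth x0).
    by apply: (sorted_leq_nth leT (fun x => leqnn _) x0 leS); rewrite ?inE ?size_tuple // ltnW.
  rewrite ltn_neqAle; apply/andP; split; last exact: lij.
  apply/negP=> /eqP/val_inj/eqP; rewrite !(tnth_nth x0).
  rewrite nth_uniq ?size_tuple //; first by move/eqP=> e; rewrite e ltnn in ij.
apply/ffunP=> a; rewrite !ffunE.
have /val_inj ts : val t = val [tuple tnth (sort_tuple le t) (s i) | i < d] by [].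
by have := congr1 (fun u => tnth u a) ts; rewrite !tnth_mktuple.
Qed.

End Incr.

(** * Counting increasing maps by their images *)

Section Count.
Variables (d n : nat).
Notation incs := (incr_seq d n).

(** Taking images is a bijection onto the [d]-subsets; a preimage of [A] comes from enumerating [A]
    and sorting. *)
Lemma sum_incr_set (phi : {set 'I_n} -> nat) :
  (\sum_(f : incs) phi [set x in codom (val f)] =
   \sum_(A : {set 'I_n} | #|A| == d) phi A)%N.
Proof.
pose im (f : incs) := [set x in codom (val f)].
have imI : injective im.
  move=> f g /setP fg; apply/val_inj/incr_eq_codom; try exact: valP.
  by move=> x; have := fg x; rewrite !inE.
rewrite [RHS](eq_bigl (fun A => A \in im @: setT)); last first.
  move=> A; apply/esym; apply/imsetP/eqP => [[f _ ->]|Ad].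
    by rewrite cardsE card_codom ?card_ord //; apply: incr_inj (valP f).
  pose g := [ffun a : 'I_d => enum_val (cast_ord (esym Ad) a)].
  have gI : injective g.
    by move=> a b; rewrite !ffunE => /enum_val_inj/cast_ord_inj.
  have [f [s [fi gf]]] := incr_sort gI.
  exists (exist _ f fi : incs) => //; apply/esym/eqP; rewrite eqEcard.
  rewrite Ad cardsE card_codom ?card_ord ?leqnn ?andbT; last exact: incr_inj.
  apply/subsetP=> x; rewrite inE => /codomP [a ->].
  have -> : val (exist _ f fi : incs) a = g ((s^-1)%g a) by rewrite gf ffunE permKV.
  by rewrite ffunE enum_valP.
by rewrite big_imset /=; [apply: eq_bigl=> f; rewrite inE | move=> f g _ _ /imI].
Qed.

Lemma count_avoid (B : {set 'I_n}) :
  (\sum_(f : incs) [forall x in B, x \notin codom (val f)])%N = 'C(n - #|B|, d).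
Proof.
have -> : (n - #|B| = #|~: B|)%N by rewrite [RHS]cardsCs setCK card_ord.
rewrite -cards_draws -sum1dep_card.
transitivity (\sum_(A : {set 'I_n} | #|A| == d) (A \subset ~: B))%N.
  rewrite -sum_incr_set; apply: eq_bigr => f _; congr nat_of_bool.
  apply/forall_inP/subsetP => [h x|h x xB].
    by rewrite !inE => xf; apply/negP=> /h; rewrite xf.
  by apply/negP=> xf; have := h x; rewrite !inE xf xB => /(_ isT).
rewrite big_mkcond [RHS]big_mkcond; apply: eq_bigr => A _.
by case: (_ == d); case: (A \subset _).
Qed.

Lemma wedge_dimE : wedge_dim d n = 'C(n, d).
Proof.
have := count_avoid set0; rewrite cards0 subn0 => <-.
rewrite (eq_bigr (fun=> 1%N)); first by rewrite sum1_card.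
by move=> f _; apply/eqP; rewrite eqb1; apply/forall_inP=> x; rewrite inE.
Qed.

End Count.

(** Complementary counting: [count_avoid] gives the maps avoiding [i], and Pascal's rule gives the
    rest. *)
Lemma count_mem d n (i : 'I_n) : (0 < d)%N ->
  (\sum_(f : incr_seq d n) (i \in codom (val f)))%N = 'C(n.-1, d.-1).
Proof.
case: n i => [[]//|n] i; case: d => // d _ /=.
apply: (@addIn 'C(n, d.+1)); rewrite [RHS]addnC -binS -(wedge_dimE d.+1 n.+1).
have := count_avoid d.+1 [set i]; rewrite cards1 subn1 /= => <-.
rewrite -big_split /wedge_dim -sum1_card; apply: eq_bigr => f _ /=.
have -> : [forall x in [set i], x \notin codom (val f)] = (i \notin codom (val f)).
  by apply/forall_inP/idP => [/(_ i)|h x /set1P-> //]; apply; rewrite inE.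
by case: (_ \in _).
Qed.

Lemma count_mem_notin d n (i j : 'I_n) : (0 < d)%N -> i != j ->
  (\sum_(f : incr_seq d n) ((i \in codom (val f)) && (j \notin codom (val f))))%N
    = 'C(n.-2, d.-1).
Proof.
case: n i j => [[]//|[|n]] i j; first by rewrite !ord1 eqxx.
case: d => // d _ ij /=.
apply: (@addIn 'C(n, d.+1)); rewrite [RHS]addnC -binS.
have := count_avoid d.+1 [set i; j]; rewrite cards2 ij subn2 /= => <-.
have := count_avoid d.+1 [set j]; rewrite cards1 subn1 /= => <-.
rewrite -big_split /=; apply: eq_bigr => f _.
have -> : [forall x in [set j], x \notin codom (val f)] = (j \notin codom (val f)).
  by apply/forall_inP/idP => [/(_ j)|h x /set1P-> //]; apply; rewrite inE.
have -> : [forall x in [set i; j], x \notin codom (val f)] =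
    (i \notin codom (val f)) && (j \notin codom (val f)).
  apply/forall_inP/andP => [h|[hi hj] x /set2P[]-> //].
  by split; apply: h; rewrite !inE eqxx ?orbT.
by do 2!case: (_ \in _).
Qed.

(** Multilinear expansion over the set [J] of columns taken from the rank-one part. Two such columns
    are proportional, so only the empty set and singletons contribute. *)
Lemma det_add_rank1 (R : comPzRingType) d (M : 'M[R]_d) (x y : 'I_d -> R) :
  \det (\matrix_(b, a) (x b * y a + M b a)) =
  \det M + \sum_c \det (\matrix_(b, a) if a == c then x b * y a else M b a).
Proof.
pose D (J : {set 'I_d}) := \det (\matrix_(b, a) if a \in J then x b * y a else M b a).
have -> : \det (\matrix_(b, a) (x b * y a + M b a)) = \sum_J D J.
  rewrite -det_tr /determinant.
  under eq_bigr => s _.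
    under eq_bigr => a _ do rewrite !mxE.
    rewrite bigA_distr mulr_sumr.
  over.
  rewrite exchange_big; apply: eq_bigr => J _; rewrite /D -det_tr.
  by apply: eq_bigr => s _; congr (_ * _); apply: eq_bigr => a _; rewrite !mxE.
have D0 (J : {set 'I_d}) a b : a \in J -> b \in J -> a != b -> D J = 0.
  move=> aJ bJ ab; pose N := \matrix_(b, a) if a \in J then x b else M b a.
  have -> : D J = \det (N *m diag_mx (\row_a if a \in J then y a else 1)).
    congr (\det _); apply/matrixP=> k l; rewrite mul_mx_diag !mxE.
    by case: ifP; rewrite ?mulr1.
  rewrite det_mulmx -det_tr (determinant_alternate ab) ?mul0r // => k.
  by rewrite !mxE aJ bJ.
pose T := [set [set c] | c : 'I_d].
rewrite (bigID (mem T)) /= addrC; congr (_ + _).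
  rewrite (bigD1 set0) /=; last first.
    by apply/imsetP=> -[c _ /setP/(_ c)]; rewrite !inE eqxx.
  rewrite big1 ?addr0; last first.
    move=> J /andP[JT /set0Pn[a aJ]].
    have /subsetPn [b bJ] : ~~ (J \subset [set a]).
      apply: contra JT => Ja; apply/imsetP; exists a => //.
      by apply/eqP; rewrite eqEsubset Ja sub1set.
    by rewrite inE => ba; apply: D0 bJ aJ ba.
  by congr (\det _); apply/matrixP=> b a; rewrite mxE inE.
rewrite big_imset /=; last by move=> a b _ _ /set1_inj.
apply: eq_big => [c|c _]; first by rewrite inE.
by congr (\det _); apply/matrixP=> b a; rewrite !mxE inE.
Qed.

Lemma mxtrace_bracket (R : comPzRingType) m (A B C : 'M[R]_m) :
  \tr ((A *m B - B *m A) *m C) = \tr (A *m (B *m C - C *m B)).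
Proof.
rewrite mulmxBl mulmxBr !raddfB /= !mulmxA; congr (_ - _).
by rewrite [in RHS]mxtrace_mulC mulmxA.
Qed.

(** * The derivation of an exterior power *)

Section Wedge.
Variables (F : fieldType) (d n : nat).
Hypothesis charF : [pchar F] =i pred0.
Notation FF := {ffun 'I_d -> 'I_n}.
Notation incs := (incr_seq d n).
Implicit Types (A : 'I_d -> 'M[F]_n) (X Y : 'M[F]_n).

(* The matrix of [A 0 (x) ... (x) A (d-1)] on the d-th tensor power of F^n, whose
   basis is indexed by all maps 'I_d -> 'I_n. *)
Definition tens A : 'M[F]_#|{: FF}| := fmx (fun f g : FF => \prod_a A a (f a) (g a)).

Lemma tens_mul A B : tens A *m tens B = tens (fun a => A a *m B a).
Proof.
apply: eq_fmx => f g; rewrite /tens mulmx_enumE fmxE.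
under [LHS]eq_bigr => h _ do rewrite !fmxE -big_split /=.
under [RHS]eq_bigr => a _ do rewrite mxE.
by rewrite bigA_distr_bigA.
Qed.

Lemma eq_tens A B : A =1 B -> tens A = tens B.
Proof.
move=> AB; apply: eq_fmx => f g; rewrite /tens !fmxE.
by apply: eq_bigr => a _; rewrite AB.
Qed.

Definition slot (c : 'I_d) X := fun a => if a == c then X else 1%:M.

(** The derivation of the tensor power induced by [X], as a Leibniz sum. *)
Definition tder X := \sum_c tens (slot c X).

Lemma tens_slot_linear c x X Y :
  tens (slot c (x *: X + Y)) = x *: tens (slot c X) + tens (slot c Y).
Proof.
apply: eq_fmx => f g; rewrite /tens [RHS]mxE [X in _ = X + _]mxE !fmxE.
rewrite !(bigD1 c (P := predT)) //= /slot eqxx.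
rewrite mxE [X in (X + _) * _]mxE mulrDl mulrA.
by congr (_ * _ + _ * _); apply: eq_bigr => a /negPf->.
Qed.

Lemma tder_linear x X Y : tder (x *: X + Y) = x *: tder X + tder Y.
Proof.
rewrite /tder scaler_sumr -big_split /=.
by apply: eq_bigr => c _; rewrite tens_slot_linear.
Qed.

Lemma slot_mul c X Y : tens (slot c X) *m tens (slot c Y) = tens (slot c (X *m Y)).
Proof.
rewrite tens_mul; apply: eq_tens => a.
by rewrite /slot; case: eqP; rewrite ?mulmx1.
Qed.

Lemma slot_comm c e X Y : c != e ->
  tens (slot c X) *m tens (slot e Y) = tens (slot e Y) *m tens (slot c X).
Proof.
move=> ce; rewrite !tens_mul; apply: eq_tens => a; rewrite /slot.
by case: (a =P c) => [->|_]; rewrite ?(negPf ce) ?mulmx1 ?mul1mx.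
Qed.

(** Operators in distinct slots commute, so only the terms with equal slots survive in the
    bracket. *)
Lemma tder_bracket X Y :
  tder (X *m Y - Y *m X) = tder X *m tder Y - tder Y *m tder X.
Proof.
have -> : X *m Y - Y *m X = (-1) *: (Y *m X) + X *m Y by rewrite scaleN1r addrC.
rewrite tder_linear scaleN1r addrC /tder !mulmx_suml.
under [in RHS]eq_bigr => c _ do rewrite mulmx_sumr.
under [X in _ = _ - X]eq_bigr => c _ do rewrite mulmx_sumr.
rewrite [X in _ = _ - X]exchange_big -!sumrB /=; apply: eq_bigr => c _.
rewrite -sumrB (bigD1 c) //= big1 ?addr0 ?slot_mul // => e ec.
by rewrite slot_comm ?subrr // eq_sym.
Qed.

(* Row f is the antisymmetrisation of [e_(f 0) (x) ... (x) e_(f (d-1))]: this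
   realises the d-th exterior power inside the d-th tensor power. *)
Definition alt_mx : 'M[F]_(wedge_dim d n, #|{: FF}|) :=
  fmx (fun (f : incs) (g : FF) => \det (\matrix_(b, a) (val f b == g a)%:R)).

(** Right multiplication by it keeps the columns at increasing maps, which reads off exterior
    coordinates. *)
Definition incl_mx : 'M[F]_(#|{: FF}|, wedge_dim d n) :=
  fmx (fun (g : FF) (f : incs) => (g == val f)%:R).

(** For each permutation [s] the sum over [h] collapses to [h = f o s], leaving the Leibniz
    expansion of the determinant. *)
Lemma alt_mx_tens A :
  alt_mx *m tens A =
  fmx (fun (f : incs) (g : FF) => \det (\matrix_(b, a) A a (val f b) (g a))).
Proof.
apply: eq_fmx => f g; rewrite /alt_mx /tens mulmx_enumE fmxE -det_tr.
transitivity (\sum_(h : FF) \sum_(s : 'S_d) (-1) ^+ s *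
    \prod_a ((val f (s a) == h a)%:R * A a (h a) (g a))).
  apply: eq_bigr => h _; rewrite !fmxE -det_tr mulr_suml.
  apply: eq_bigr => s _; rewrite -mulrA -big_split /=; congr (_ * _).
  by apply: eq_bigr => a _; rewrite !mxE.
rewrite exchange_big; apply: eq_bigr => s _ /=; rewrite -mulr_sumr; congr (_ * _).
rewrite -(bigA_distr_bigA (fun a k => (val f (s a) == k)%:R * A a k (g a))).
apply: eq_bigr => a _; rewrite !mxE (bigD1 (val f (s a))) //= eqxx mul1r big1 ?addr0 //.
by move=> k; rewrite eq_sym => /negPf->; rewrite mul0r.
Qed.

Lemma mulmx_incl m (K : 'M[F]_(m, #|{: FF}|)) i (g : incs) :
  (K *m incl_mx) i (enum_rank g) = K i (enum_rank (val g)).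
Proof.
rewrite mxE sum_enum_rank (bigD1 (val g)) //= /incl_mx fmxE eqxx mulr1 big1 ?addr0 //.
by move=> h hg; rewrite fmxE (negPf hg) mulr0.
Qed.

(** Distinct increasing maps have distinct images of the same size, so some value of [f] is missed
    by [g] and gives a zero row. *)
Lemma alt_mx_incl : alt_mx *m incl_mx = 1%:M.
Proof.
apply: eq_fmx => f g; rewrite mulmx_incl /alt_mx fmxE mxE (inj_eq enum_rank_inj).
have fi := incr_inj (valP f); have gi := incr_inj (valP g).
case: eqP => [<-|fg].
  rewrite -[RHS](det1 F d); congr (\det _); apply/matrixP => b a.
  by rewrite !mxE (inj_eq fi).
have /existsP [b /forallP fb] : [exists b, forall a, val f b != val g a].
  apply: contraT => /existsPn H; case: fg; apply/val_inj.
  apply: incr_eq_codom (valP f) (valP g) _.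
  apply/subset_cardP; first by rewrite !card_codom.
  apply/subsetP=> x /codomP [b ->]; have /forallPn [a] := H b.
  by rewrite negbK => /eqP ->; apply: codom_f.
by rewrite (expand_det_row _ b) big1 // => a _; rewrite mxE (negPf (fb a)) mul0r.
Qed.

(** Each row of [K], read as a tensor, is antisymmetric. *)
Definition row_alt m (K : 'M[F]_(m, #|{: FF}|)) :=
  forall i (g : FF) (s : 'S_d),
    K i (enum_rank [ffun a => g (s a)]) = (-1) ^+ s * K i (enum_rank g).

Lemma det_col_perm (s : 'S_d) (M : 'M[F]_d) : \det (col_perm s M) = (-1) ^+ s * \det M.
Proof. by rewrite col_permE det_mulmx det_perm odd_permV mulrC. Qed.

Lemma row_alt_alt_mx : row_alt alt_mx.
Proof.
move=> i g s; rewrite /alt_mx -(enum_valK i) !fmxE -det_col_perm; congr (\det _).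
by apply/matrixP=> b a; rewrite !mxE ffunE.
Qed.

(** Permuting positions also permutes the slots, so the sum over slots is preserved up to the sign
    of each determinant. *)
Lemma row_alt_tder X : row_alt (alt_mx *m tder X).
Proof.
move=> i g s; rewrite -(enum_valK i) /tder mulmx_sumr !summxE mulr_sumr.
rewrite [RHS](reindex_inj (@perm_inj _ s)); apply: eq_bigr => c _.
rewrite !alt_mx_tens !fmxE -det_col_perm; congr (\det _).
by apply/matrixP=> b a; rewrite !mxE ffunE /slot (inj_eq perm_inj).
Qed.

Lemma row_altM m p (L : 'M_(p, m)) (K : 'M[F]_(m, #|{: FF}|)) :
  row_alt K -> row_alt (L *m K).
Proof.
move=> aK i g s; rewrite !mxE mulr_sumr; apply: eq_bigr => j _.
by rewrite aK mulrCA.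
Qed.

Lemma row_alt_noninj m (K : 'M[F]_(m, #|{: FF}|)) i (g : FF) (a b : 'I_d) :
  row_alt K -> a != b -> g a = g b -> K i (enum_rank g) = 0.
Proof.
move=> aK ab gab.
have := aK i g (tperm a b); rewrite odd_tperm ab expr1 mulN1r.
have -> : [ffun c => g (tperm a b c)] = g.
  by apply/ffunP => c; rewrite ffunE; case: tpermP => // ->.
move/eqP; rewrite -addr_eq0 -mulr2n -mulr_natl mulf_eq0.
by rewrite (pcharf0P F).1 //= => /eqP.
Qed.

(** An antisymmetric tensor vanishes at non-injective indices, and an injective index sorts to an
    increasing one up to sign. *)
Lemma row_alt_incr m (K L : 'M[F]_(m, #|{: FF}|)) :
  row_alt K -> row_alt L -> K *m incl_mx = L *m incl_mx -> K = L.
Proof.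
move=> aK aL KL; apply/matrixP => i j; rewrite -(enum_valK j); move: (enum_val j) => g.
have [/injectiveP gI|] := boolP (injectiveb g); last first.
  move/injectivePn=> [a [b ab gab]].
  by rewrite (row_alt_noninj i aK ab gab) (row_alt_noninj i aL ab gab).
have [f [s [fi ->]]] := incr_sort gI; rewrite aK aL; congr (_ * _).
have E (M : 'M[F]_(m, #|{: FF}|)) :
    M i (enum_rank f) = (M *m incl_mx) i (enum_rank (exist _ f fi : incs)).
  by rewrite mulmx_incl.
by rewrite !E KL.
Qed.

(** The derivation D of the exterior power: [tder X] applied to antisymmetrised basis tensors, in
    exterior coordinates. *)
Definition wder X := alt_mx *m tder X *m incl_mx.

(** Antisymmetric tensors are stable under [tder X], which acts on them by [wder X]. This transfers
    the bracket identity to D. *)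
Lemma wder_alt X : alt_mx *m tder X = wder X *m alt_mx.
Proof.
apply: row_alt_incr; [exact: row_alt_tder | exact/row_altM/row_alt_alt_mx |].
by rewrite -[RHS]mulmxA alt_mx_incl mulmx1.
Qed.

Lemma wder_linear x X Y : wder (x *: X + Y) = x *: wder X + wder Y.
Proof. by rewrite /wder tder_linear mulmxDr mulmxDl -scalemxAr -scalemxAl. Qed.

Lemma wder_bracket X Y :
  wder (X *m Y - Y *m X) = wder X *m wder Y - wder Y *m wder X.
Proof.
have E U V : alt_mx *m (tder U *m tder V) *m incl_mx = wder U *m wder V.
  by rewrite [X in _ = _ *m X]/wder !mulmxA wder_alt.
by rewrite [LHS]/wder tder_bracket mulmxBr mulmxBl !E.
Qed.

HB.instance Definition _ :=
  GRing.isLinear.Build F 'M[F]_n 'M[F]_(wedge_dim d n) _ wder wder_linear.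

Lemma det_delta (f g : incs) :
  \det (\matrix_(b, a) (val f b == val g a)%:R : 'M[F]_d) = (f == g)%:R.
Proof.
have /matrixP/(_ (enum_rank f) (enum_rank g)) := alt_mx_incl.
by rewrite mulmx_incl /alt_mx fmxE mxE (inj_eq enum_rank_inj).
Qed.

Lemma wderE X (f g : incs) : wder X (enum_rank f) (enum_rank g) =
  \sum_c \det (\matrix_(b, a) slot c X a (val f b) (val g a)).
Proof.
rewrite /wder mulmx_incl /tder mulmx_sumr summxE.
by apply: eq_bigr => c _; rewrite alt_mx_tens fmxE.
Qed.

(** Each minor expands by [det_add_rank1], with no term beyond first order. *)
Lemma wedge_mx_add_rank1 (u : 'cV[F]_n) (v : 'rV_n) :
  wedge_mx d (1%:M + u *m v) = 1%:M + wder (u *m v).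
Proof.
have uvE i j : (u *m v) i j = u i 0 * v 0 j by rewrite mxE big_ord1.
apply: eq_fmx => f g; rewrite /wedge_mx [LHS]mxE [RHS]mxE wderE [X in _ = X + _]mxE.
rewrite !enum_rankK.
rewrite (inj_eq enum_rank_inj) -det_delta.
transitivity (\det (\matrix_(b, a)
    (u (val f b) 0 * v 0 (val g a) + (\matrix_(b, a) (val f b == val g a)%:R : 'M_d) b a))).
  by congr (\det _); apply/matrixP=> b a; rewrite !mxE -uvE mxE addrC.
rewrite det_add_rank1; congr (_ + _); apply: eq_bigr => c _.
congr (\det _); apply/matrixP=> b a; rewrite !mxE /slot.
by case: eqP => // _; rewrite ?uvE // mxE.
Qed.

Lemma wder_diag (x : 'rV[F]_n) :
  wder (diag_mx x) = diag_mx (\row_k \sum_c x 0 (val (enum_val k : incs) c)).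
Proof.
apply: eq_fmx => f g; rewrite wderE mxE mxE enum_rankK (inj_eq enum_rank_inj).
transitivity (\sum_c (f == g)%:R * x 0 (val g c)).
  apply: eq_bigr => c _; rewrite -det_delta.
  transitivity (\det ((\matrix_(b, a) (val f b == val g a)%:R) *m
      diag_mx (\row_a if a == c then x 0 (val g a) else 1))).
    congr (\det _); apply/matrixP => b a; rewrite mul_mx_diag !mxE /slot.
    case: eqP => _; rewrite mxE ?mulr1 //.
    by case: (_ =P _) => [->|_]; rewrite ?mul0r ?mul1r.
  rewrite det_mulmx det_diag; congr (_ * _).
  rewrite (bigD1 c) //= !mxE eqxx big1 ?mulr1 // => a /negPf ac.
  by rewrite mxE ac.
by rewrite -mulr_sumr; case: eqP => [->|_]; rewrite ?mul1r ?mul0r.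
Qed.

Hypothesis d_gt0 : (0 < d)%N.

(** The coefficient of tr X tr Y in the trace form is written [tr_coef - form_coef]. For 2 <= d and
    2 <= n it is C(n-2,d-2) by Pascal's rule; for d = 1 it is 0, where a truncated [d.-2] would
    wrongly give 1. *)
Notation tr_coef := ('C(n.-1, d.-1)%:R : F).
Notation form_coef := ('C(n.-2, d.-1)%:R : F).
Notation E i j := (@delta_mx F n n i j).

Lemma delta_diag i : E i i = diag_mx (delta_mx 0 i).
Proof.
apply/matrixP=> j k; rewrite !mxE eqxx /=; case: (j =P k) => [->|jk].
  by rewrite andbb.
by case: (j =P i) => // ji; case: (k =P i) => // ki; case: jk; rewrite ji ki.
Qed.

Lemma wder_delta_diag i :
  wder (E i i) = diag_mx (\row_k (i \in codom (val (enum_val k : incs)))%:R).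
Proof.
rewrite delta_diag wder_diag; congr diag_mx; apply/rowP=> k; rewrite !mxE.
move: (enum_val k : incs) => f; under eq_bigr => c _ do rewrite mxE eqxx /=.
have fI := incr_inj (valP f).
have [/codomP[c ->]|nf] := boolP (i \in codom (val f)).
  rewrite (bigD1 c) //= eqxx big1 ?addr0 // => e ec.
  by rewrite (inj_eq fI) (negPf ec).
rewrite big1 // => c _; case: eqP => // fc.
by rewrite -fc codom_f in nf.
Qed.

(** Off-diagonal units are brackets, which reduces the trace computations to diagonal units. *)
Lemma delta_bracket i j : i != j -> E i j = E i i *m E i j - E i j *m E i i.
Proof.
by move=> ij; rewrite !mul_delta_mx_cond eqxx eq_sym (negPf ij) mulr1n mulr0n subr0.
Qed.

Lemma tr_wder_delta_comm i j (W : 'M[F]_(wedge_dim d n)) :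
  \tr (wder (E i i) *m (wder (E j j) *m W - W *m wder (E j j))) = 0.
Proof.
rewrite !wder_delta_diag mulmxBr raddfB /= mulmxA [X in _ - \tr X]mulmxA.
by rewrite [X in _ - X]mxtrace_mulC mulmxA diag_mxC subrr.
Qed.

Lemma tr_wder X : \tr (wder X) = tr_coef * \tr X.
Proof.
rewrite [in LHS](matrix_sum_delta X) !linear_sum [in RHS]/mxtrace mulr_sumr.
apply: eq_bigr => i _; rewrite !linear_sum /= (bigD1 i) //= big1 ?addr0.
  rewrite !linearZ /= mulrC; congr (_ * _); rewrite wder_delta_diag mxtrace_diag.
  rewrite sum_enum_rank -(count_mem i d_gt0) natr_sum; apply: eq_bigr => f _.
  by rewrite mxE enum_rankK.
move=> j ji; rewrite !linearZ /= (@delta_bracket i j) 1?eq_sym // wder_bracket //.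
by rewrite raddfB /= mxtrace_mulC subrr mulr0.
Qed.

(** The trace counts the increasing maps through both [i] and [j]: for [i != j], those through [i]
    minus those among them that avoid [j]. *)
Lemma tr_wder_delta2 i j :
  \tr (wder (E i i) *m wder (E j j)) = form_coef * (i == j)%:R + (tr_coef - form_coef).
Proof.
rewrite !wder_delta_diag mulmx_diag mxtrace_diag sum_enum_rank.
under eq_bigr => f _ do rewrite !mxE enum_rankK.
have [<-|ij] := eqVneq i j.
  rewrite mulr1 addrC subrK -(count_mem i d_gt0) natr_sum; apply: eq_bigr => f _.
  by case: (_ \in _); rewrite ?mulr0 ?mulr1.
rewrite mulr0 add0r -(count_mem i d_gt0) -(count_mem_notin d_gt0 ij) !natr_sum -sumrB.
apply: eq_bigr => f _.
by do 2!case: (_ \in _); rewrite ?mulr0 ?mulr1 ?subr0 ?subrr.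
Qed.

Lemma tr_wder_delta i X :
  \tr (wder (E i i) *m wder X) = form_coef * X i i + (tr_coef - form_coef) * \tr X.
Proof.
have Ej j : \sum_k \tr (wder (E i i) *m wder (X j k *: E j k)) =
    form_coef * (X j j * (i == j)%:R) + (tr_coef - form_coef) * X j j.
  rewrite (bigD1 j) //= big1 ?addr0.
    by rewrite linearZ -scalemxAr linearZ /= tr_wder_delta2; ring.
  move=> k kj; rewrite linearZ -scalemxAr linearZ /= (@delta_bracket j k) 1?eq_sym //.
  by rewrite wder_bracket // tr_wder_delta_comm mulr0.
rewrite [in LHS](matrix_sum_delta X) linear_sum mulmx_sumr linear_sum /=.
under eq_bigr => j _ do rewrite linear_sum mulmx_sumr linear_sum Ej.
rewrite big_split /= -!mulr_sumr; congr (_ * _ + _).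
rewrite (bigD1 i) //= eqxx mulr1 big1 ?addr0 // => j /negPf ji.
by rewrite eq_sym ji mulr0.
Qed.

(** By linearity [X] is a matrix unit. An off-diagonal unit is a bracket with a diagonal one, and
    invariance of the trace form moves that bracket onto [Y]. *)
Lemma tr_wder_mul X Y :
  \tr (wder X *m wder Y) = form_coef * \tr (X *m Y) + (tr_coef - form_coef) * (\tr X * \tr Y).
Proof.
have Ed j k : \tr (wder (E j k) *m wder Y) =
    form_coef * Y k j + (tr_coef - form_coef) * ((j == k)%:R * \tr Y).
  have [<-|jk] := eqVneq j k; first by rewrite tr_wder_delta mul1r.
  rewrite mul0r mulr0 addr0 delta_bracket // wder_bracket //.
  rewrite mxtrace_bracket -wder_bracket //.
  rewrite tr_wder_delta raddfB /= (mxtrace_mulC Y) subrr mulr0 addr0; congr (_ * _).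
  rewrite !mxE (bigD1 k) //= big1 ?addr0 => [|l /negPf lk]; last by rewrite mxE lk andbF mul0r.
  rewrite mxE !eqxx mul1r big1 ?subr0 // => l _.
  by rewrite mxE (negPf jk) andbF mulr0.
rewrite [in LHS](matrix_sum_delta X) linear_sum mulmx_suml linear_sum /=.
transitivity (\sum_j (form_coef * (\sum_k X j k * Y k j) +
                     (tr_coef - form_coef) * (X j j * \tr Y))).
  apply: eq_bigr => j _; rewrite linear_sum mulmx_suml linear_sum /=.
  under eq_bigr => k _ do rewrite linearZ -scalemxAl linearZ /= Ed mulrDr.
  rewrite big_split mulr_sumr /=; congr (_ + _).
    by apply: eq_bigr => k _; rewrite mulrCA.
  rewrite (bigD1 j) //= eqxx mul1r mulrCA big1 ?addr0 // => k /negPf kj.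
  by rewrite eq_sym kj mul0r !mulr0.
rewrite big_split /= -!mulr_sumr -mulr_suml; congr (_ * _ + _).
by apply: eq_bigr => j _; rewrite mxE.
Qed.

End Wedge.

(** * Reflections and intertwiners *)

Lemma ltn_bin2l n1 n2 m : (0 < m)%N -> (m <= n2)%N -> (n1 < n2)%N ->
  ('C(n1, m) < 'C(n2, m))%N.
Proof.
case: n2 => // n2; case: m => // m _ mn; rewrite ltnS => n12.
apply: leq_ltn_trans (leq_bin2l _ n12) _.
by rewrite binS -[in X in (X < _)%N](addn0 'C(n2, m.+1)) ltn_add2l bin_gt0.
Qed.

(** The identity d C(n,d) = n C(n-1,d-1) yields d1/n1 = d2/n2. If d1 < d2 then also n1-d1 < n2-d2,
    and C(n1,d1) <= C(d1+n2-d2,d1) < C(n2,d2), a contradiction. *)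
Lemma bin_ratio_inj n1 d1 n2 d2 :
  (1 <= d1 <= n1.-1)%N -> (1 <= d2 <= n2.-1)%N ->
  'C(n1, d1) = 'C(n2, d2) -> 'C(n1.-1, d1.-1) = 'C(n2.-1, d2.-1) ->
  d1 = d2 /\ n1 = n2.
Proof.
wlog le_d : n1 d1 n2 d2 / (d1 <= d2)%N.
  move=> IH h1 h2 e1 e2; have [le|/ltnW le] := leqP d1 d2; first exact: IH.
  by have [] := IH _ _ _ _ le h2 h1 (esym e1) (esym e2).
move=> /andP[d1_gt0 dn1] /andP[d2_gt0 dn2] eqC eqC'.
have E1 := mul_bin_diag n1 d1.-1; have E2 := mul_bin_diag n2 d2.-1.
rewrite !prednK // in E1 E2.
have C_gt0 : (0 < 'C(n2, d2))%N by rewrite bin_gt0; lia.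
have C'_gt0 : (0 < 'C(n2.-1, d2.-1))%N by rewrite bin_gt0; lia.
have ratio : (d1 * n2 = d2 * n1)%N.
  apply/eqP; rewrite -(eqn_pmul2r C_gt0) -(eqn_pmul2r C'_gt0); apply/eqP.
  rewrite eqC eqC' in E1; move: E1 E2 => /=; nia.
have [lt_d|] := ltnP d1 d2; last by move=> ge_d; split; nia.
have lt_nd : (n1 - d1 < n2 - d2)%N by nia.
suff: ('C(n1, d1) < 'C(n2, d2))%N by rewrite eqC ltnn.
apply: (@leq_ltn_trans 'C(d1 + (n2 - d2), d1)); first by apply: leq_bin2l; lia.
rewrite -bin_sub ?leq_addr // addKn -[X in (_ < X)%N]bin_sub; last lia.
by apply: ltn_bin2l; lia.
Qed.

(** * Rank-one perturbations of the identity *)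

Section Rank1.
Variables (F : fieldType) (n : nat).
Implicit Types (X s : 'M[F]_n) (u : 'cV[F]_n) (v : 'rV[F]_n).

Lemma rank1_sandwich u v X :
  (u *m v) *m X *m (u *m v) = \tr ((u *m v) *m X) *: (u *m v).
Proof.
have -> : \tr (u *m v *m X) = (v *m X *m u) 0 0.
  by rewrite -mulmxA mxtrace_mulC [LHS]big_ord1.
transitivity (u *m (v *m X *m u) *m v); first by rewrite !mulmxA.
by rewrite {1}[v *m X *m u]mx11_scalar mul_mx_scalar -scalemxAl.
Qed.

Lemma rank1_square u v : (u *m v) *m (u *m v) = \tr (u *m v) *: (u *m v).
Proof. by have := rank1_sandwich u v 1%:M; rewrite !mulmx1. Qed.

(** Trace zero would make N = s - 1 square to zero; being diagonalizable, N would vanish, against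
    rank one. *)
Lemma reflection_rank1 s : is_reflection s ->
  exists u v, s = 1%:M + u *m v /\ \tr (u *m v) != 0.
Proof.
case=> -[P Pu Pdiag] rk1.
have sE : s = 1%:M + (s - 1%:M) by rewrite addrC subrK.
have [u [v uv]] : exists (u : 'cV_n) (v : 'rV_n), s - 1%:M = u *m v.
  rewrite -(mulmx_base (s - 1%:M)).
  move: (col_base _) (row_base _); rewrite rk1 => u v; by exists u, v.
exists u, v; rewrite -uv -sE; split=> //; rewrite uv.
apply/eqP => tr0; have := rank1_square u v; rewrite tr0 scale0r -uv => sq0.
have /(similar_diagLR Pu)[D sD] := Pdiag.
have NE : s - 1%:M = invmx P *m diag_mx (D - const_mx 1) *m P.
  rewrite raddfB /= diag_const_mx mulmxBr mulmxBl mulmx1 mulVmx // sD.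
  by rewrite conjVmx.
have : diag_mx (D - const_mx 1) *m diag_mx (D - const_mx 1) = 0.
  have -> : diag_mx (D - const_mx 1) = P *m (s - 1%:M) *m invmx P.
    by rewrite NE !mulmxA mulmxV // mul1mx mulmxK.
  by rewrite !mulmxA mulmxKV // -(mulmxA P) sq0 mulmx0 mul0mx.
rewrite mulmx_diag => /matrixP D0.
suff N0 : s - 1%:M = 0 by rewrite N0 mxrank0 in rk1.
rewrite NE; have -> : D - const_mx 1 = 0; last by rewrite raddf0 mulmx0 mul0mx.
apply/rowP=> i; have := D0 i i; rewrite mxE eqxx mulr1n mxE [RHS]mxE => /eqP.
by rewrite mulf_eq0 orbb => /eqP ->; rewrite mxE.
Qed.

(** The Sherman-Morrison formula. If 1 + tr N were 0, then N = (1 + tr N) R N would vanish, against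
    tr N <> 0. *)
Lemma inv_add_rank1 R u v : R *m (1%:M + u *m v) = 1%:M -> \tr (u *m v) != 0 ->
  R = 1%:M - (1 + \tr (u *m v))^-1 *: (u *m v).
Proof.
have := rank1_square u v; move: (u *m v) => N NN.
set c := \tr N; rewrite mulmxDr mulmx1 => RE c0.
have cRN : (1 + c) *: (R *m N) = N.
  rewrite scalerDl scale1r scalemxAr -NN mulmxA -mulmxDl RE.
  by rewrite mul1mx.
have c1 : 1 + c != 0.
  apply: contraNneq c0 => c1; rewrite c1 scale0r in cRN.
  by rewrite /c -cRN linear0.
have -> : (1 + c)^-1 *: N = R *m N by rewrite -[in LHS]cRN scalerA mulVf ?scale1r.
by rewrite -RE addrK.
Qed.

End Rank1.

(** * Injectivity of D *)

Section Injective.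
Variables (F : fieldType) (d n : nat).
Hypothesis charF : [pchar F] =i pred0.
Hypothesis dn : (1 <= d <= n.-1)%N.

Lemma bin_pred_neq0 : ('C(n.-1, d.-1)%:R : F) != 0.
Proof. by rewrite (pcharf0P F).1 // -lt0n bin_gt0; lia. Qed.

Lemma bin_pred2_neq0 : ('C(n.-2, d.-1)%:R : F) != 0.
Proof. by rewrite (pcharf0P F).1 // -lt0n bin_gt0; lia. Qed.

(** First tr X = 0; then pairing with [delta_mx j i] in the trace form returns a non-zero multiple
    of the entry [X i j]. *)
Lemma wder_inj (X : 'M[F]_n) : wder d X = 0 -> X = 0.
Proof.
have d_gt0 : (0 < d)%N by case/andP: dn.
move=> DX0.
have trX : \tr X = 0.
  have := tr_wder charF d_gt0 X; rewrite DX0 linear0 => /esym/eqP.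
  by rewrite mulf_eq0 (negPf bin_pred_neq0) => /eqP.
apply/matrixP => i j; rewrite [RHS]mxE.
have := tr_wder_mul charF d_gt0 X (delta_mx j i).
rewrite DX0 mul0mx linear0 trX mul0r mulr0 addr0 => /esym/eqP.
rewrite mulf_eq0 (negPf bin_pred2_neq0) => /eqP <-.
rewrite /mxtrace (bigD1 i) //= big1 ?addr0 => [|k ki].
  rewrite mxE (bigD1 j) //= mxE !eqxx mulr1 big1 ?addr0 // => l /negPf lj.
  by rewrite mxE lj mulr0.
by rewrite mxE big1 // => l _; rewrite mxE (negPf ki) andbF mulr0.
Qed.

End Injective.

(** The sizes of [P] are not syntactically equal, so its pseudo-inverse replaces the inverse in the
    conjugation. *)
Lemma tr_intertwine (F : fieldType) m1 m2 (P : 'M[F]_(m2, m1)) A1 A2 :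
  row_free P -> row_full P -> P *m A1 = A2 *m P -> \tr A1 = \tr A2.
Proof.
move=> Pfree Pfull PA.
rewrite -[A1]mul1mx -(mulVpmx Pfull) -mulmxA PA mulmxA mxtrace_mulC mulmxA.
by rewrite mulmxVp // mul1mx.
Qed.

Lemma intertwineM (R : pzSemiRingType) m1 m2 (P : 'M[R]_(m2, m1)) A1 A2 B1 B2 :
  P *m A1 = A2 *m P -> P *m B1 = B2 *m P -> P *m (A1 *m B1) = (A2 *m B2) *m P.
Proof. by move=> hA hB; rewrite mulmxA hA -!mulmxA hB. Qed.

(** * The Lie algebra of intertwined pairs *)

Section Intertwine.
Variables (F : fieldType) (d n : nat).
Hypothesis charF : [pchar F] =i pred0.
Hypothesis dn : (1 <= d <= n.-1)%N.
Variable P : 'M[F]_(wedge_dim d n).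
Hypotheses (Pfree : row_free P) (Pfull : row_full P).
Implicit Types X Y : 'M[F]_n.

Definition intertw X1 X2 := P *m wder d X1 = wder d X2 *m P.

Lemma intertw_linear x X1 X2 Y1 Y2 : intertw X1 X2 -> intertw Y1 Y2 ->
  intertw (x *: X1 + Y1) (x *: X2 + Y2).
Proof.
rewrite /intertw !wder_linear mulmxDr mulmxDl -scalemxAr -scalemxAl.
by move=> -> ->.
Qed.

Lemma intertw_bracket X1 X2 Y1 Y2 : intertw X1 X2 -> intertw Y1 Y2 ->
  intertw (X1 *m Y1 - Y1 *m X1) (X2 *m Y2 - Y2 *m X2).
Proof.
rewrite /intertw !wder_bracket // mulmxBr mulmxBl => hX hY.
by rewrite (intertwineM hX hY) (intertwineM hY hX).
Qed.

Lemma intertw_tr X1 X2 : intertw X1 X2 -> \tr X1 = \tr X2.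
Proof.
have d_gt0 : (0 < d)%N by case/andP: dn.
move/(tr_intertwine Pfree Pfull); rewrite !tr_wder //.
exact/mulfI/bin_pred_neq0.
Qed.

(** The tr X tr Y terms of [tr_wder_mul] agree and cancel; the remaining coefficient is non-zero. *)
Lemma intertw_trM X1 X2 Y1 Y2 : intertw X1 X2 -> intertw Y1 Y2 ->
  \tr (X1 *m Y1) = \tr (X2 *m Y2).
Proof.
have d_gt0 : (0 < d)%N by case/andP: dn.
move=> hX hY.
have : P *m (wder d X1 *m wder d Y1) = (wder d X2 *m wder d Y2) *m P.
  exact: intertwineM.
move/(tr_intertwine Pfree Pfull); rewrite !tr_wder_mul //.
rewrite (intertw_tr hX) (intertw_tr hY) => /addIr.
exact/mulfI/bin_pred2_neq0.
Qed.

(** With N N = c N and N X N = t N, the double bracket is c (N X + X N) - 2 t N; adding c [N,X]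
    removes X N. *)
Lemma rank1_mul_bracket (u : 'cV[F]_n) (v : 'rV_n) X (N := u *m v)
    (B := N *m X - X *m N) :
  (2 * \tr N) *: (N *m X) =
  (2 * \tr (N *m X)) *: N + (\tr N *: B + (N *m B - B *m N)).
Proof.
rewrite {}/B; have NN := rank1_square u v; have NXN := rank1_sandwich u v X.
rewrite -/N in NN NXN; set c := \tr N in NN *; set t := \tr (N *m X) in NXN *.
have E1 : N *m (N *m X) = c *: (N *m X) by rewrite mulmxA NN -scalemxAl.
have E2 : N *m (X *m N) = t *: N by rewrite mulmxA.
have E3 : X *m N *m N = c *: (X *m N) by rewrite -mulmxA NN -scalemxAr.
rewrite mulmxBr mulmxBl E1 E2 NXN E3; move: (N *m X) (X *m N) => A C.
by apply/matrixP=> i j; rewrite !mxE; ring.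
Qed.

(** [rank1_mul_bracket] expresses the product by brackets and traces, which intertwined pairs
    respect; 2 tr N is then divided out. *)
Lemma intertw_rank1_mul (u1 u2 : 'cV[F]_n) (v1 v2 : 'rV_n) X1 X2 :
  \tr (u1 *m v1) != 0 -> intertw (u1 *m v1) (u2 *m v2) -> intertw X1 X2 ->
  intertw ((u1 *m v1) *m X1) ((u2 *m v2) *m X2).
Proof.
move=> c0 hN hX.
have c2 : 2 * \tr (u1 *m v1) != 0.
  by rewrite mulf_neq0 // (pcharf0P F).1.
have : intertw ((2 * \tr (u1 *m v1)) *: ((u1 *m v1) *m X1))
               ((2 * \tr (u2 *m v2)) *: ((u2 *m v2) *m X2)).
  rewrite !rank1_mul_bracket -(intertw_tr hN) -(intertw_trM hN hX).
  apply: (intertw_linear _ hN); apply: intertw_linear.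
    exact: intertw_bracket.
  by apply/intertw_bracket/intertw_bracket.
have wderZ x Y : wder d (x *: Y) = x *: wder d Y by exact: linearZ.
rewrite /intertw -(intertw_tr hN) !wderZ -scalemxAr -scalemxAl.
exact: scalerI.
Qed.

End Intertwine.

(** * Stable subspaces that are graphs *)

Section Graph.
Variables (W : groupType) (F : fieldType) (n : nat).
Variables (rho1 rho2 : W -> 'M[F]_n) (m : nat) (K : 'M[F]_(m, n + n)).

(** The first projection of [K] is non-zero and stable, hence onto. Trivial intersection with the
    second factor makes [K] a graph, and with the first makes the resulting map injective. *)
Lemma graph_rep_iso : rep_irreducible rho1 ->
  (forall (w : W) (x1 x2 : 'rV_n), (row_mx x1 x2 <= K)%MS ->
     (row_mx (x1 *m (rho1 w)^T) (x2 *m (rho2 w)^T) <= K)%MS) ->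
  (forall x : 'rV_n, (row_mx 0 x <= K)%MS -> x = 0) ->
  (forall x : 'rV_n, (row_mx x 0 <= K)%MS -> x = 0) ->
  K != 0 -> rep_iso rho1 rho2.
Proof.
move=> [_ irr] stK inj1 inj2 K_neq0.
have rowK i : (row_mx (row i (lsubmx K)) (row i (rsubmx K)) <= K)%MS.
  by rewrite -row_row_mx hsubmxK row_sub.
have K1full : row_full (lsubmx K).
  suff: row_full <<lsubmx K>>%MS by rewrite /row_full genmxE.
  case: (irr <<lsubmx K>>%MS) => // [w|/eqP].
    rewrite !genmxE (eqmxMr _ (genmxE _)); apply/row_subP => i; rewrite row_mul.
    have /(stK w)/submxP[D /(congr1 lsubmx)] := rowK i.
    by rewrite row_mxKl -mulmx_lsub => ->; apply: submxMl.
  rewrite -mxrank_eq0 genmxE mxrank_eq0 => /eqP K1_0; case/eqP: K_neq0.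
  apply/row_matrixP => i; rewrite -[K]hsubmxK row_row_mx K1_0 !row0.
  have := rowK i; rewrite K1_0 row0 => /inj1 ->; exact: row_mx0.
have [B graphK] : exists B : 'M_n, forall x : 'rV_n, (row_mx x (x *m B) <= K)%MS.
  exists (pinvmx (lsubmx K) *m rsubmx K) => x.
  rewrite -[x in row_mx x _]mulmx1 -(mulVpmx K1full) !mulmxA -mul_mx_row hsubmxK.
  exact: submxMl.
have graph_uniq (x y : 'rV_n) : (row_mx x y <= K)%MS -> y = x *m B.
  move=> xy; apply/eqP; rewrite -subr_eq0; apply/eqP/inj1.
  rewrite -(subrr x) -add_row_mx -opp_row_mx.
  by apply: addmx_sub xy _; rewrite eqmx_opp graphK.
have Bfree : row_free B.
  by apply: inj_row_free => x xB; apply: inj2; have := graphK x; rewrite xB.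
(* Row vectors stand for columns, hence the transpose. *)
exists B^T; split.
- by rewrite row_free_unit unitmx_tr -row_free_unit.
- by rewrite row_full_unit unitmx_tr -row_free_unit.
move=> w; apply: trmx_inj; rewrite !trmx_mul !trmxK; apply/row_matrixP => i.
by rewrite !rowE !mulmxA; apply/esym/graph_uniq/stK/graphK.
Qed.

End Graph.

Lemma rep_stable_gens (W : groupType) (k : nat) (S : 'I_k -> W) (F : fieldType)
    (n1 n2 : nat) (rho1 : W -> 'M[F]_n1) (rho2 : W -> 'M[F]_n2)
    (V : 'rV[F]_n1 -> 'rV[F]_n2 -> Prop) :
  generates S -> is_rep rho1 -> is_rep rho2 ->
  (forall i x1 x2, V x1 x2 -> V (x1 *m (rho1 (S i))^T) (x2 *m (rho2 (S i))^T)) ->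
  (forall i x1 x2, V x1 x2 ->
     V (x1 *m (rho1 (S i)^-1%g)^T) (x2 *m (rho2 (S i)^-1%g)^T)) ->
  forall w x1 x2, V x1 x2 -> V (x1 *m (rho1 w)^T) (x2 *m (rho2 w)^T).
Proof.
move=> gS [r1_1 r1M] [r2_1 r2M] VS VSV w.
elim: (gS w) => [x1 x2|{}w i _ IH x1 x2|{}w i _ IH x1 x2].
- by rewrite r1_1 r2_1 !trmx1 !mulmx1.
- by move=> /(VS i)/IH; rewrite r1M r2M !trmx_mul !mulmxA.
- by move=> /(VSV i)/IH; rewrite r1M r2M !trmx_mul !mulmxA.
Qed.

(** Without generators every element acts trivially, and the line spanned by the first basis vector
    is a proper stable subspace. *)
Lemma irreducible_gens (W : groupType) (k : nat) (S : 'I_k -> W) (F : fieldType)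
    (n : nat) (rho : W -> 'M[F]_n) :
  generates S -> is_rep rho -> rep_irreducible rho -> (1 < n)%N -> (0 < k)%N.
Proof.
case: k S => // S gS [r1 _] [_ irr] n1.
have rho1 w : rho w = 1%:M by elim: (gS w) => // {}w [].
have rk : \rank (pid_mx 1 : 'M[F]_n) = 1%N by rewrite rank_pid_mx // ltnW.
case: (irr (pid_mx 1)) => [w|U0|]; first by rewrite rho1 trmx1 mulmx1.
  by rewrite U0 mxrank0 in rk.
by rewrite /row_full rk => /eqP n_1; rewrite -n_1 in n1.
Qed.

Lemma natr_char0_inj (F : fieldType) : [pchar F] =i pred0 ->
  injective (fun m : nat => m%:R : F).
Proof.
move=> charF m1 m2 /=; wlog le_m : m1 m2 / (m1 <= m2)%N.
  move=> IH m12; have [le|/ltnW le] := leqP m1 m2; first exact: IH.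
  exact/esym/IH.
move/esym/eqP; rewrite -subr_eq0 -natrB // (pcharf0P F).1 // subn_eq0 => le_m'.
by apply/eqP; rewrite eqn_leq le_m.
Qed.

Lemma wder_intertwine (F : fieldType) n1 n2 d1 d2
    (P : 'M[F]_(wedge_dim d2 n2, wedge_dim d1 n1)) (s1 : 'M[F]_n1) (s2 : 'M[F]_n2)
    (u1 : 'cV[F]_n1) (v1 : 'rV[F]_n1) (u2 : 'cV[F]_n2) (v2 : 'rV[F]_n2) :
  s1 = 1%:M + u1 *m v1 -> s2 = 1%:M + u2 *m v2 ->
  P *m wedge_mx d1 s1 = wedge_mx d2 s2 *m P ->
  P *m wder d1 (u1 *m v1) = wder d2 (u2 *m v2) *m P.
Proof.
move=> -> ->; rewrite !wedge_mx_add_rank1 mulmxDl mulmxDr mulmx1 mul1mx.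
exact: addrI.
Qed.

(** * Recovering the degree and the dimension *)

Section Params.
Variable F : fieldType.
Hypothesis charF : [pchar F] =i pred0.
Variables (n1 n2 d1 d2 : nat).
Hypotheses (dn1 : (1 <= d1 <= n1.-1)%N) (dn2 : (1 <= d2 <= n2.-1)%N).
Variables (u1 : 'cV[F]_n1) (v1 : 'rV[F]_n1) (u2 : 'cV[F]_n2) (v2 : 'rV[F]_n2).
Variable P : 'M[F]_(wedge_dim d2 n2, wedge_dim d1 n1).
Hypothesis PD : P *m wder d1 (u1 *m v1) = wder d2 (u2 *m v2) *m P.

(** With c = tr N and p = C(n-1,d-1), the traces of D N and its square are p c and p c^2, as N N = c
    N. Equality on both sides gives c1 = c2, then p1 = p2. *)
Lemma wedge_iso_params : row_free P -> row_full P -> \tr (u1 *m v1) != 0 ->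
  d1 = d2 /\ n1 = n2.
Proof.
move=> Pfree Pfull c1_neq0.
have d1_gt0 : (0 < d1)%N by case/andP: dn1.
have d2_gt0 : (0 < d2)%N by case/andP: dn2.
have trD := tr_intertwine Pfree Pfull PD.
have trD2 := tr_intertwine Pfree Pfull (intertwineM PD PD).
rewrite !tr_wder // in trD.
rewrite !tr_wder_mul // !rank1_square !linearZ /= in trD2.
rewrite -!mulrDl !(addrC 'C(_.-2, _)%:R) !subrK !mulrA trD in trD2.
have p2_neq0 := bin_pred_neq0 charF dn2.
have p1_neq0 := bin_pred_neq0 charF dn1.
have c2_neq0 : \tr (u2 *m v2) != 0.
  apply: contra_neq c1_neq0 => c2; move/eqP: trD.
  by rewrite c2 mulr0 mulf_eq0 (negPf p1_neq0) => /eqP.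
have c12 : \tr (u1 *m v1) = \tr (u2 *m v2).
  by apply: mulfI trD2; rewrite mulf_neq0.
have p12 : 'C(n1.-1, d1.-1) = 'C(n2.-1, d2.-1).
  have /eqP : 'C(n1.-1, d1.-1)%:R = 'C(n2.-1, d2.-1)%:R :> F.
    by apply: (mulIf c1_neq0); rewrite trD c12.
  by move=> /eqP/(natr_char0_inj charF).
apply: bin_ratio_inj => //; rewrite -!wedge_dimE.
(* Both sizes of [P] equal its rank, so C(n1,d1) = C(n2,d2). *)
exact: etrans (esym (eqP Pfull)) (eqP Pfree).
Qed.

End Params.

(** * The isomorphism in equal degree and dimension *)

Section SameDim.
Variables (W : groupType) (k : nat) (S : 'I_k -> W) (F : fieldType) (n d : nat).
Variables (rho1 rho2 : W -> 'M[F]_n).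
Hypotheses (charF : [pchar F] =i pred0) (dn : (1 <= d <= n.-1)%N).
Hypotheses (gS : generates S) (irr1 : rep_irreducible rho1).
Hypotheses (refl1 : reflection_rep S rho1) (refl2 : reflection_rep S rho2).
Variable P : 'M[F]_(wedge_dim d n).
Hypotheses (Pfree : row_free P) (Pfull : row_full P).
Hypothesis Prho : forall w, P *m wedge_rep d rho1 w = wedge_rep d rho2 w *m P.

Lemma rep_iso_of_wedge : rep_iso rho1 rho2.
Proof.
have [rep1 ref1] := refl1; have [rep2 ref2] := refl2.
have n_gt1 : (1 < n)%N by lia.
pose i0 := Ordinal (irreducible_gens gS rep1 irr1 n_gt1).
have decomp i : exists (u1 : 'cV_n) (v1 : 'rV_n) (u2 : 'cV_n) (v2 : 'rV_n),
   [/\ rho1 (S i) = 1%:M + u1 *m v1, rho2 (S i) = 1%:M + u2 *m v2,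
       \tr (u1 *m v1) != 0 & intertw P (u1 *m v1) (u2 *m v2)].
  have [u1 [v1 [s1E c1]]] := reflection_rank1 (ref1 i).
  have [u2 [v2 [s2E c2]]] := reflection_rank1 (ref2 i).
  exists u1, v1, u2, v2; split=> //; exact: wder_intertwine s1E s2E (Prho (S i)).
have [a1 [b1 [a2 [b2 [_ _ c0 h0]]]]] := decomp i0.
(* The pairs (x1, x2) with (x1 b1, x2 b2) intertwined form the kernel of this linear map; [mxvec]
   flattens its values so that [kermx] applies. *)
pose phi (x : 'rV[F]_(n + n)) := mxvec (P *m wder d ((lsubmx x)^T *m b1) -
                                wder d ((rsubmx x)^T *m b2) *m P).
have phi_lin : linear phi.
  move=> c x y; rewrite /phi !linearP /= !mulmxDl -!scalemxAl !wder_linear.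
  rewrite mulmxDr mulmxDl -scalemxAr -scalemxAl opprD addrACA -scalerBr.
  by rewrite linearP.
pose phiL : {linear 'rV[F]_(n + n) -> 'rV_(_ * _)} :=
  HB.pack phi (GRing.isLinear.Build _ _ _ _ phi phi_lin).
pose K := kermx (lin1_mx phiL).
have KP x1 x2 : reflect (intertw P (x1^T *m b1) (x2^T *m b2)) (row_mx x1 x2 <= K)%MS.
  apply: (iffP sub_kermxP); rewrite mul_rV_lin1 /= /phi row_mxKl row_mxKr.
    by move/eqP; rewrite mxvec_eq0 subr_eq0 => /eqP.
  by move=> ->; rewrite subrr linear0.
have tr0 (u : 'cV[F]_n) (v : 'rV_n) : \tr (u *m v) = (v *m u) 0 0.
  by rewrite mxtrace_mulC [LHS]big_ord1.
have rank1_inj (u : 'cV[F]_n) (v : 'rV_n) (x : 'rV_n) :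
    \tr (u *m v) != 0 -> x^T *m v = 0 -> x = 0.
  move=> c xv0; have := congr1 (fun M => M *m u) xv0.
  rewrite -mulmxA [v *m u]mx11_scalar -tr0 mul_mx_scalar mul0mx => /eqP.
  by rewrite scaler_eq0 (negPf c) => /eqP/(congr1 trmx); rewrite trmxK trmx0.
(* One scalar [c] serves both inverses because N1 and N2 have the same trace. *)
have N_stable i (x1 x2 : 'rV_n) : exists2 N : 'M_n * 'M_n,
     [/\ rho1 (S i) = 1%:M + N.1, rho2 (S i) = 1%:M + N.2 &
       exists c, rho1 (S i)^-1%g = 1%:M + c *: N.1 /\ rho2 (S i)^-1%g = 1%:M + c *: N.2] &
     (row_mx x1 x2 <= K)%MS -> (row_mx (x1 *m N.1^T) (x2 *m N.2^T) <= K)%MS.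
  have [u1 [v1 [u2 [v2 [s1E s2E c hN]]]]] := decomp i.
  exists (u1 *m v1, u2 *m v2); last first.
    rewrite /= => hx; apply/KP; move/KP: hx => hx.
    rewrite (trmx_mul x1) (trmx_mul x2) !trmxK -!(mulmxA (_ *m _)).
    exact: intertw_rank1_mul.
  split=> //=; exists (- (1 + \tr (u1 *m v1))^-1); split; rewrite scaleNr.
    apply: inv_add_rank1 => //; rewrite -s1E -rep1.2 mulVg; exact: rep1.1.
  rewrite (intertw_tr charF dn Pfree Pfull hN) in c *.
  apply: inv_add_rank1 => //; rewrite -s2E -rep2.2 mulVg; exact: rep2.1.
have addN_stable c (N1 N2 : 'M_n) (x1 x2 : 'rV_n) : (row_mx x1 x2 <= K)%MS ->
    (row_mx (x1 *m N1^T) (x2 *m N2^T) <= K)%MS ->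
    (row_mx (x1 *m (1%:M + c *: N1)^T) (x2 *m (1%:M + c *: N2)^T) <= K)%MS.
  move=> hx hN; rewrite !linearD !linearZ /= !trmx1 !mulmx1.
  by rewrite -add_row_mx -scale_row_mx addmx_sub ?scalemx_sub.
(* A pair (x, 0) gives P D(x b1) = 0; cancelling [P], injectivity of D and tr (a1 b1) <> 0 give x =
   0 in turn. *)
have KV0 : forall x : 'rV_n, (row_mx x 0 <= K)%MS -> x = 0.
  move=> x /KP; rewrite /intertw trmx0 mul0mx linear0 mul0mx => PD0.
  apply: (rank1_inj _ _ _ c0); apply: (wder_inj charF dn).
  by rewrite -[LHS]mul1mx -(mulVpmx Pfull) -mulmxA PD0 mulmx0.
have K0V : forall x : 'rV_n, (row_mx 0 x <= K)%MS -> x = 0.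
  move=> x /KP; rewrite /intertw trmx0 mul0mx linear0 mulmx0 => /esym PD0.
  rewrite (intertw_tr charF dn Pfree Pfull h0) in c0.
  apply: (rank1_inj _ _ _ c0); apply: (wder_inj charF dn).
  by rewrite -[LHS]mulmx1 -(mulmxVp Pfree) mulmxA PD0 mul0mx.
apply: (graph_rep_iso (K := K)) => //.
  apply: (rep_stable_gens (V := fun x1 x2 => (row_mx x1 x2 <= K)%MS) gS rep1 rep2).
    move=> i x1 x2 hx; have [N [-> -> _] /(_ hx) hN] := N_stable i x1 x2.
    by rewrite -[N.1]scale1r -[N.2]scale1r; apply: addN_stable.
  move=> i x1 x2 hx; have [N [_ _ [c [-> ->]]] /(_ hx) hN] := N_stable i x1 x2.
  exact: addN_stable.
(* [K] contains (a1, a2), and a1 = 0 would contradict tr (a1 b1) <> 0. *)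
apply/eqP => K_0; have /KP : intertw P ((a1^T)^T *m b1) ((a2^T)^T *m b2) by rewrite !trmxK.
rewrite K_0 submx0 row_mx_eq0 => /andP[/eqP/(congr1 trmx) a1_0 _].
by rewrite trmxK trmx0 in a1_0; rewrite a1_0 mul0mx linear0 eqxx in c0.
Qed.

End SameDim.

Theorem theorem1p3 (W : groupType) (k : nat) (S : 'I_k -> W)
    (F : fieldType) (n1 n2 : nat)
    (rho1 : W -> 'M[F]_n1) (rho2 : W -> 'M[F]_n2) (d1 d2 : nat) :
  generates S ->
  [pchar F] =i pred0 ->
  reflection_rep S rho1 -> rep_irreducible rho1 ->
  reflection_rep S rho2 -> rep_irreducible rho2 ->
  (1 <= d1 <= n1.-1)%N -> (1 <= d2 <= n2.-1)%N ->
  rep_iso (wedge_rep d1 rho1) (wedge_rep d2 rho2) ->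
  [/\ d1 = d2, n1 = n2 & rep_iso rho1 rho2].
Proof.
move=> gS charF refl1 irr1 refl2 irr2 dn1 dn2 [P [Pfree Pfull Prho]].
have [rep1 ref1] := refl1; have [rep2 ref2] := refl2.
have n1_gt1 : (1 < n1)%N by lia.
pose i0 := Ordinal (irreducible_gens gS rep1 irr1 n1_gt1).
have [u1 [v1 [s1E c1]]] := reflection_rank1 (ref1 i0).
have [u2 [v2 [s2E c2]]] := reflection_rank1 (ref2 i0).
have PD := wder_intertwine s1E s2E (Prho (S i0)).
(* A single generator already matches degrees and dimensions; substituting them gives [rho1] and
   [rho2] the same matrix size. *)
have [d12 n12] := wedge_iso_params charF dn1 dn2 PD Pfree Pfull c1.
subst d2 n2; split=> //.
exact: (rep_iso_of_wedge charF dn1 gS irr1 refl1 refl2 Pfree Pfull Prho).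
Qed.
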